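(* Let $T\in L(H)$ be an operator satisfying hypothesis $(h)$ and let $B=\{h\in H: h\text{ is algebraic with respect to }T\}$. If $B$ is a closed subspace of $H$, then for $a\in H$ the following statements are equivalent: (i) $[a]\in H/B$ is algebraic with respect to $T_B$. (ii) $a$ is algebraic with respect to $T$.
   Context: $\Omega$ is a bounded finitely connected region in $\mathbb{C}$ whose boundary $\partial\Omega$ consists of a finite number of disjoint, analytic, simple closed curves. $H$ is a complex Hilbert space and $L(H)$ is the algebra of bounded linear operators on $H$. $H^\infty(\Omega)$ is the Banach algebra of bounded holomorphic functions on $\Omega$ with the supremum norm; via nontangential boundary values it is identified with a weak$^*$-closed subalgebra of $L^\infty(\partial\Omega)$ (with respect to harmonic measure for a fixed point of $\Omega$), from which it receives its weak$^*$ topology. Hypothesis $(h)$: $T\in L(H)$ satisfies hypothesis $(h)$ if $\overline{\Omega}$ is a spectral set for $T$ (i.e. $\sigma(T)\subseteq\overline{\Omega}$ and $\|r(T)\|\le \max_{z\in\overline\Omega}|r(z)|$ for every rational function $r=p/q$ with poles off $\overline{\Omega}$, where $r(T)=q(T)^{-1}p(T)$) and $T$ has no normal summand with spectrum in $\partial\Omega$ (i.e. there is no nonzero reducing subspace $N$ of $T$ with $T|N$ normal and $\sigma(T|N)\subseteq\partial\Omega$). Functional calculus: for $T$ satisfying $(h)$ there is a unique algebra representation $f\mapsto f(T)$ of $H^\infty(\Omega)$ into $L(H)$ with $1(T)=I_H$, $z(T)=T$, continuous for the weak$^*$ topologies, and contractive. An element $h\in H$ is algebraic with respect to $T$ if $\theta(T)h=0$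 for some $\theta\in H^\infty(\Omega)\setminus\{0\}$. $R(\Omega)$ is the algebra of rational functions with poles off $\overline\Omega$. A closed subspace $N$ of $H$ is $R(\Omega)$-invariant for $T$ if it is invariant under $u(T)$ for every $u\in R(\Omega)$ (when $B$ is closed, it is $R(\Omega)$-invariant for $T$). For an $R(\Omega)$-invariant subspace $N$, define $T_N:H/N\to H/N$ by $T_N([h])=[Th]$ and, for $\theta\in H^\infty(\Omega)$, $\theta(T_N):H/N\to H/N$ by $\theta(T_N)([h])=[\theta(T)h]$. An element $[h]\in H/N$ is algebraic with respect to $T_N$ if $\theta(T_N)[h]=0$ for some $\theta\in H^\infty(\Omega)\setminus\{0\}$. *)

(* Defs.v *)
From HB Require Import structures.
From mathcomp Require Import all_boot all_order all_algebra.
From mathcomp Require Import generic_quotient ring_quotient sesquilinear.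
From mathcomp Require Import all_classical all_reals all_analysis.
From mathcomp Require Import complex.

Set Implicit Arguments.
Unset Strict Implicit.
Unset Printing Implicit Defensive.

Import Order.TTheory GRing.Theory Num.Theory.
Import numFieldNormedType.Exports.

Local Open Scope classical_set_scope.
Local Open Scope ring_scope.
Local Open Scope quotient_scope.

(* The library gives every abstract numClosedFieldType its metric structure, but
   these instances are not found on the head symbol [complex]. *)
HB.instance Definition _ (R : realType) :=
  PseudoPointedMetric.copy R[i] R[i]^o.
HB.instance Definition _ (R : realType) := NormedModule.copy R[i] R[i]^o.

(* In a normed space over R[i] the norm `|x| is an element of R[i]; [rnorm x] is
   the same number seen in R. *)
Definition rnorm (R : realType) (V : normedModType R[i]) (x : V) : R :=
  complex.Re `|x|.

Section PlaneRegions.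
Variable R : realType.
Implicit Types (Omega G : set R[i]) (f : R[i] -> R[i]) (u : R[i] -> R).

Definition boundary Omega : set R[i] := closure Omega `\` interior Omega.

Definition holomorphic_on Omega f : Prop :=
  forall z, Omega z -> derivable f z 1.

(* An analytic simple closed curve is the image of the unit circle under a map
   which is holomorphic and injective on a neighbourhood of the circle. *)
Definition analytic_simple_closed_curve G : Prop :=
  exists (U : set R[i]) (phi : R[i] -> R[i]),
    [/\ open U, [set z : R[i] | `|z| = 1] `<=` U, holomorphic_on U phi,
        set_inj U phi & G = phi @` [set z : R[i] | `|z| = 1]].

(* Since Omega is bounded, the components of its complement in the Riemann
   sphere correspond to those of its complement in the plane: adding the point
   at infinity only enlarges the unique unbounded one. *)
Definition finitely_connected Omega : Prop :=
  finite_set [set connected_component (~` Omega) z | z in ~` Omega].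

Record analytic_region Omega : Prop := AnalyticRegion {
  region_nonempty : Omega !=set0;
  region_open : open Omega;
  region_connected : connected Omega;
  region_bounded : bounded_set Omega;
  region_finitely_connected : finitely_connected Omega;
  region_boundary : exists (n : nat) (G : 'I_n -> set R[i]),
    [/\ forall k, analytic_simple_closed_curve (G k),
        trivIset [set: 'I_n] G & boundary Omega = \bigcup_k G k] }.

Definition sup_norm Omega f : R := sup [set rnorm (f z) | z in Omega].

(* Elements of H^oo(Omega) are represented by total functions on R[i]; only
   their values on Omega matter. *)
Definition Hinf Omega : set (R[i] -> R[i]) :=
  [set f | holomorphic_on Omega f /\ bounded_set (f @` Omega)].

Definition nonzero_on Omega f : Prop := exists2 z, Omega z & f z != 0.

Definition partial (v : R[i]) u : R[i] -> R :=
  fun z => derive1 (fun t : R => u (z + t%:C%C * v)) 0.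

Definition C1_on Omega u : Prop :=
  forall v : R[i], v = 1 \/ v = 'i%C -> forall z, Omega z ->
    derivable (fun t : R => u (z + t%:C%C * v)) 0 1 /\
    {for z, continuous (partial v u)}.

Definition harmonic_on Omega u : Prop :=
  [/\ C1_on Omega u, C1_on Omega (partial 1 u), C1_on Omega (partial 'i%C u)
    & forall z, Omega z ->
        partial 1 (partial 1 u) z + partial 'i%C (partial 'i%C u) z = 0].

Definition Borel_plane := g_sigma_algebraType (@open R[i]).

(* The harmonic measure of Omega at z0: the Borel probability measure on the
   boundary whose integrals give the values at z0 of the solutions of the
   Dirichlet problem. *)
Definition harmonic_measure Omega (z0 : R[i]) (omega : probability Borel_plane R)
  : Prop :=
  omega (boundary Omega : set Borel_plane) = 1%E /\
  forall u, {within closure Omega, continuous u} -> harmonic_on Omega u ->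
    u z0 = \int[omega]_(z in (boundary Omega : set Borel_plane)) u z.

(* The nontangential approach region at zeta: |z - zeta| < alpha dist(z, bd). *)
Definition Stolz_region Omega (alpha : R) (zeta : R[i]) : set R[i] :=
  [set z | Omega z /\
    forall w, boundary Omega w -> rnorm (z - zeta) < alpha * rnorm (z - w)].

Definition nontangential_limit Omega f (zeta l : R[i]) : Prop :=
  forall alpha : R, 1 < alpha ->
    f @ within (Stolz_region Omega alpha zeta) (nbhs zeta) --> l.

(* Nontangential limits of bounded holomorphic functions exist off a set of
   harmonic measure zero, on which the value 0 is used. *)
Definition boundary_value Omega f : R[i] -> R[i] :=
  fun zeta => xget 0 [set l | nontangential_limit Omega f zeta l].

Section WeakStar.
Variables (Omega : set R[i]) (omega : probability Borel_plane R).
Local Notation bd := (boundary Omega : set Borel_plane).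

Definition L1_boundary (g : R[i] -> R[i]) : Prop :=
  omega.-integrable bd (fun z => (complex.Re (g z))%:E) /\
  omega.-integrable bd (fun z => (complex.Im (g z))%:E).

Definition boundary_integral (g : R[i] -> R[i]) : R[i] :=
  ((\int[omega]_(z in bd) complex.Re (g z)) +i*
   (\int[omega]_(z in bd) complex.Im (g z)))%C.

(* The pairing of H^oo(Omega), inside L^oo of the boundary, with L^1. *)
Definition Hinf_pairing f : {ptws {g | L1_boundary g} -> R[i]} :=
  fun g => boundary_integral (fun z => boundary_value Omega f z * sval g z).

Definition Hinf_weakstar : Type := initial_topology Hinf_pairing.
HB.instance Definition _ := Topological.on Hinf_weakstar.

End WeakStar.
End PlaneRegions.

Section HilbertSpace.
Variables (R : realType) (H : completeNormedModType R[i]).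
Implicit Types (ip : {dot H for @Num.conj R[i]}) (A T : H -> H) (N : set H).

(* H is a Hilbert space: the inner product [ip] induces its (complete) norm. *)
Definition induces_norm ip : Prop := forall x : H, `|x| ^+ 2 = ip x x.

Record closed_subspace := ClosedSubspace {
  subspace_carrier :> set H;
  subspace0 : subspace_carrier 0;
  subspaceP : forall (c : R[i]) (x y : H), subspace_carrier x ->
    subspace_carrier y -> subspace_carrier (c *: x + y);
  subspace_closed : closed subspace_carrier }.

(* Bounded operators of a subspace N into itself are represented by total
   functions on H; only their values on N matter. *)
Definition bounded_operator_on N A : Prop :=
  [/\ forall x, N x -> N (A x),
      forall (c : R[i]) (x y : H), N x -> N y -> A (c *: x + y) = c *: A x + A y
    & {within N, continuous A}].

Definition bounded_operator A : Prop := bounded_operator_on [set: H] A.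

Definition inverse_on N A S : Prop :=
  bounded_operator_on N S /\ forall x, N x -> S (A x) = x /\ A (S x) = x.

(* The spectrum of the restriction of A to the invariant subspace N. *)
Definition spectrum_on N A : set R[i] :=
  [set l | ~ exists S, inverse_on N (fun x => A x - l *: x) S].

Definition spectrum A : set R[i] := spectrum_on [set: H] A.

Definition op_norm A : R := sup [set rnorm (A x) | x in [set x | rnorm x <= 1]].

Definition poly_op (p : {poly R[i]}) A : H -> H :=
  fun x => \sum_(k < size p) p`_k *: iter k A x.

Definition inverse_op A : H -> H :=
  xget (fun=> 0) [set S | inverse_on [set: H] A S].

(* r(A) = q(A)^-1 p(A) for r = p / q *)
Definition rat_op (p q : {poly R[i]}) A : H -> H :=
  inverse_op (poly_op q A) \o poly_op p A.

Definition spectral_set (K : set R[i]) A : Prop :=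
  spectrum A `<=` K /\
  forall p q : {poly R[i]}, (forall z, K z -> q.[z] != 0) ->
    op_norm (rat_op p q A) <= sup_norm K (fun z => p.[z] / q.[z]).

Definition orthogonal_complement ip N : set H :=
  [set y | forall x, N x -> ip x y = 0].

Definition reducing ip N A : Prop :=
  (forall x, N x -> N (A x)) /\
  (forall x, orthogonal_complement ip N x -> orthogonal_complement ip N (A x)).

Definition adjoint_on ip N A A' : Prop :=
  bounded_operator_on N A' /\
  forall x y, N x -> N y -> ip (A x) y = ip x (A' y).

Definition normal_on ip N A : Prop :=
  exists2 A', adjoint_on ip N A A' & forall x, N x -> A (A' x) = A' (A x).

Definition hypothesis_h ip (Omega : set R[i]) T : Prop :=
  [/\ bounded_operator T,
      spectral_set (closure Omega) T
    & forall N : closed_subspace, (exists2 x, (N : set H) x & x != 0) ->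
        reducing ip N T -> normal_on ip N T ->
        ~ (spectrum_on N T `<=` boundary Omega)].

Definition square_summable (x : nat -> H) : Prop :=
  cvgn (series (fun n => rnorm (x n) ^+ 2)).

(* The weak* topology of L(H), as the dual of the trace class operators: the
   weak* continuous functionals are A |-> \sum_n <A x_n, y_n> with square
   summable (x_n) and (y_n). *)
Definition trace_pairing ip A :
  {ptws {xy : (nat -> H) * (nat -> H) |
          square_summable xy.1 /\ square_summable xy.2} -> R[i]} :=
  fun xy => limn (series (fun n => ip (A ((sval xy).1 n)) ((sval xy).2 n))).

Definition operator_weakstar ip : Type := initial_topology (trace_pairing ip).
HB.instance Definition _ ip := Topological.on (operator_weakstar ip).

(* f |-> f(T), the values of [Phi] outside H^oo(Omega) being irrelevant *)
Record functional_calculus ip (Omega : set R[i])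
    (omega : probability (Borel_plane R) R) T
    (Phi : (R[i] -> R[i]) -> H -> H) : Prop := FunctionalCalculus {
  fcalc_ext : forall f g, Hinf Omega f -> Hinf Omega g ->
    (forall z, Omega z -> f z = g z) -> Phi f = Phi g;
  fcalc_bounded : forall f, Hinf Omega f -> bounded_operator (Phi f);
  fcalc_linear : forall (c : R[i]) f g, Hinf Omega f -> Hinf Omega g ->
    Phi (fun z => c * f z + g z) = (fun h => c *: Phi f h + Phi g h);
  fcalc_mul : forall f g, Hinf Omega f -> Hinf Omega g ->
    Phi (fun z => f z * g z) = Phi f \o Phi g;
  fcalc_one : Phi (fun=> 1) = id;
  fcalc_id : Phi id = T;
  fcalc_weakstar : {within (Hinf Omega : set (Hinf_weakstar Omega omega)),
    continuous (Phi : Hinf_weakstar Omega omega -> operator_weakstar ip)};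
  fcalc_contractive : forall f, Hinf Omega f ->
    op_norm (Phi f) <= sup_norm Omega f }.

Definition algebraic (Omega : set R[i]) (Phi : (R[i] -> R[i]) -> H -> H) (h : H)
  : Prop :=
  exists theta, [/\ Hinf Omega theta, nonzero_on Omega theta & Phi theta h = 0].

Definition in_subspace (N : closed_subspace) : {pred H} := fun h => `[< (N : set H) h >].

Lemma in_subspaceE (N : closed_subspace) h : (h \in in_subspace N) = `[< (N : set H) h >].
Proof. by []. Qed.

Lemma in_subspace_zmod_closed (N : closed_subspace) :
  zmod_closed (in_subspace N).
Proof.
split=> [|x y]; rewrite !in_subspaceE; first exact/asboolP/subspace0.
move=> /asboolP Nx /asboolP Ny; apply/asboolP.
by rewrite addrC -scaleN1r; apply: subspaceP.
Qed.

HB.instance Definition _ (N : closed_subspace) :=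
  GRing.isZmodClosed.Build H (in_subspace N) (in_subspace_zmod_closed N).

Definition quotient (N : closed_subspace) : zmodType :=
  Quotient.quot (in_subspace N).

Definition coset (N : closed_subspace) (h : H) : quotient N :=
  \pi_(Quotient.quot (in_subspace N)) h.

(* The operator [h] |-> [A h] on H / N, for N invariant under A. *)
Definition quotient_op (N : closed_subspace) A : quotient N -> quotient N :=
  fun x => coset N (A (repr (x : Quotient.quot (in_subspace N)))).

Lemma coset_eq (N : closed_subspace) x y : coset N x = coset N y <-> (N : set H) (x - y).
Proof.
split=> [/eqP|Nxy]; last apply/eqP;
  rewrite /coset -Quotient.idealrBE in_subspaceE; last exact/asboolP.
by move/asboolP.
Qed.

Lemma quotient_opE (N : closed_subspace) A h :
  bounded_operator A -> (forall x, (N : set H) x -> (N : set H) (A x)) ->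
  quotient_op A (coset N h) = coset N (A h).
Proof.
move=> [_ linA _] invA; apply/coset_eq.
have AB x y : A (x - y) = A x - A y.
  by rewrite -scaleN1r [x + _]addrC linA // scaleN1r addrC.
rewrite -AB; apply: invA; apply/coset_eq.
by rewrite /coset reprK.
Qed.

Definition algebraic_in_quotient (Omega : set R[i])
    (Phi : (R[i] -> R[i]) -> H -> H) (N : closed_subspace) (x : quotient N)
  : Prop :=
  exists theta, [/\ Hinf Omega theta, nonzero_on Omega theta
                  & quotient_op (Phi theta) x = 0].

End HilbertSpace.

(* Main.v *)
Require Import Defs.
From HB Require Import structures.
From mathcomp Require Import all_boot all_order all_algebra.
From mathcomp Require Import generic_quotient ring_quotient sesquilinear.
From mathcomp Require Import all_classical all_reals all_analysis.
From mathcomp Require Import complex.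
From mathcomp Require Import ring lra.

Set Implicit Arguments.
Unset Strict Implicit.
Unset Printing Implicit Defensive.

Import Order.TTheory GRing.Theory Num.Theory.
Import numFieldNormedType.Exports.
Import ComplexField.Normc.

Local Open Scope classical_set_scope.
Local Open Scope ring_scope.

(** If [theta(T) a] lies in [B], the set of algebraic elements, then some nonzero
    [eta] gives [eta(T) (theta(T) a) = 0].  The functional calculus is
    multiplicative, so [eta theta] annihilates [a], and all that is left to know
    is that [eta theta] is not the zero function.  Hence the theorem rests on the
    fact that the holomorphic functions on a connected open set form an integral
    domain ([nonzero_onM]), which is the identity theorem.  The converse is
    clear, since [theta(T) a = 0] lies in [B].

    The identity theorem is derived from complex differentiability at each
    point, without power series.  Goursat's bisection argument shows that the
    integral of a holomorphic function along the boundary of a rectangle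
    vanishes ([goursat]); an isolated point near which the function is bounded
    does no harm ([goursat_punctured]).  Applied to [(g z - g w) / (z - w)] this
    bounds [g w] by a constant times the supremum of [g] on the boundary, the
    constant depending on the rectangle and on [w] alone ([cauchy_estimate]).
    If [f] vanishes near the centre [c] of a square, every quotient
    [f z / (z - c) ^+ n] is holomorphic there, so the same constant serves for
    all of them; as [n] grows this forces [f] to vanish on the inscribed disc
    ([zero_propagates]).  Connectedness does the rest. *)

(** * The modulus of a complex number *)

Section Modulus.
Variable R : realType.
Implicit Types (z : R[i]) (M : R).

Lemma normr_normc z : `|z| = (normc z)%:C%C.
Proof. by case: z. Qed.

Lemma normc_ge0 z : 0 <= normc z.
Proof. by case: z => a b; exact: sqrtr_ge0. Qed.

Lemma normc_gt0 z : z != 0 -> 0 < normc z.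
Proof.
move=> z0; rewrite lt_def normc_ge0 andbT.
by apply: contra_neq z0 => /eq0_normc.
Qed.

Lemma normr_Re_le z : `|complex.Re z| <= normc z.
Proof.
by case: z => a b /=; rewrite -sqrtr_sqr ler_wsqrtr// lerDl sqr_ge0.
Qed.

Lemma normr_Im_le z : `|complex.Im z| <= normc z.
Proof.
by case: z => a b /=; rewrite -sqrtr_sqr ler_wsqrtr// lerDr sqr_ge0.
Qed.

Lemma normc_le_ReIm z : normc z <= `|complex.Re z| + `|complex.Im z|.
Proof.
case: z => a b /=; rewrite -(@ler_pXn2r _ 2)// ?nnegrE ?addr_ge0 ?sqrtr_ge0//.
rewrite sqr_sqrtr ?addr_ge0 ?sqr_ge0// sqrrD !real_normK ?num_real//.
by rewrite lerD2r lerDl mulrn_wge0// mulr_ge0.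
Qed.

Lemma normcX z n : normc (z ^+ n) = normc z ^+ n.
Proof.
by elim: n => [|n ih]; [rewrite !expr0 normc1|rewrite !exprS normcM ih].
Qed.

Lemma normc_sum_le z1 z2 M1 M2 :
  normc z1 <= M1 -> normc z2 <= M2 -> normc (z1 + z2) <= M1 + M2.
Proof. by move=> h1 h2; apply: (le_trans (le_normcD _ _)); exact: lerD. Qed.

Lemma nbhs_normcP z (P : R[i] -> Prop) :
  (\forall x \near z, P x) <->
  exists2 d : R, 0 < d & forall x, normc (x - z) < d -> P x.
Proof.
split=> [/nbhs_ballP[d /= d0 dP]|[d d0 dP]].
  have dE : d = (complex.Re d)%:C%C by rewrite RRe_real// gtr0_real.
  move: d0 dP; rewrite dE ltcR => d0 dP; exists (complex.Re d) => // x xz.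
  apply: dP; rewrite -ball_normE/= distrC normr_normc ltcR//.
apply/nbhs_ballP; exists d%:C%C => /=; first by rewrite ltcR.
move=> x; rewrite -ball_normE/= distrC normr_normc ltcR => h; exact: dP.
Qed.

Lemma continuous_normcP (T : topologicalType) (f : T -> R[i]) x :
  {for x, continuous f} <->
  forall e : R, 0 < e -> \forall y \near x, normc (f y - f x) < e.
Proof.
split=> [/cvgrPdist_lt fx e e0|fx].
  have := fx e%:C%C; rewrite ltcR => /(_ e0); apply: filterS => y.
  by rewrite distrC normr_normc ltcR.
apply/cvgrPdist_lt => e e0.
have eE : e = (complex.Re e)%:C%C by rewrite RRe_real// gtr0_real.
move: e0; rewrite eE ltcR => /fx; apply: filterS => y.
by rewrite distrC normr_normc ltcR.
Qed.

Lemma continuous_Re_comp (T : topologicalType) (f : T -> R[i]) x :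
  {for x, continuous f} -> {for x, continuous (fun y => complex.Re (f y))}.
Proof.
move=> /continuous_normcP fx; apply/cvgrPdist_lt => e /fx; apply: filterS => y.
by apply: le_lt_trans; rewrite distrC -raddfB; exact: normr_Re_le.
Qed.

Lemma continuous_Im_comp (T : topologicalType) (f : T -> R[i]) x :
  {for x, continuous f} -> {for x, continuous (fun y => complex.Im (f y))}.
Proof.
move=> /continuous_normcP fx; apply/cvgrPdist_lt => e /fx; apply: filterS => y.
by apply: le_lt_trans; rewrite distrC -raddfB; exact: normr_Im_le.
Qed.

Lemma continuous_horizontal (f : R[i] -> R[i]) (x y : R) :
  {for (x +i* y)%C, continuous f} ->
  {for x, continuous (fun t => f (t +i* y)%C)}.
Proof.
move=> /continuous_normcP fz; apply/continuous_normcP => e /fz/nbhs_normcP[d d0 dP].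
apply/nbhs_ballP; exists d => //= t; rewrite /ball/= distrC => td; apply: dP.
by rewrite /= subrr expr0n addr0 sqrtr_sqr.
Qed.

Lemma continuous_vertical (f : R[i] -> R[i]) (x y : R) :
  {for (x +i* y)%C, continuous f} ->
  {for y, continuous (fun t => f (x +i* t)%C)}.
Proof.
move=> /continuous_normcP fz; apply/continuous_normcP => e /fz/nbhs_normcP[d d0 dP].
apply/nbhs_ballP; exists d => //= t; rewrite /ball/= distrC => td; apply: dP.
by rewrite /= subrr expr0n add0r sqrtr_sqr.
Qed.

Lemma ReB z w : complex.Re (z - w) = complex.Re z - complex.Re w.
Proof. exact: raddfB. Qed.

Lemma ImB z w : complex.Im (z - w) = complex.Im z - complex.Im w.
Proof. exact: raddfB. Qed.

Lemma Im_inv (x y : R) : complex.Im ((x +i* y)%C)^-1 = - y / (x ^+ 2 + y ^+ 2).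
Proof. by rewrite /= mulNr. Qed.

Lemma Re_inv (x y : R) : complex.Re ((x +i* y)%C)^-1 = x / (x ^+ 2 + y ^+ 2).
Proof. by []. Qed.

End Modulus.

(** * Complex differentiability *)

Section Differentiability.
Variable R : realType.
Implicit Types (f g : R[i] -> R[i]) (c z : R[i]).

Lemma derivable_affine_approx f p : derivable f p 1 ->
  exists c : R[i], forall e : R, 0 < e -> exists2 d : R, 0 < d &
    forall z, normc (z - p) < d ->
      normc (f z - (c * (z - p) + f p)) <= e * normc (z - p).
Proof.
move=> /cvg_ex[/= l fl]; exists l => e e0.
have /cvgrPdist_lt/(_ e%:C%C) := fl; rewrite ltcR => /(_ e0).
move=> /nbhs_normcP[d d0 dP]; exists d => // z zpd.
have [->|zp] := eqVneq z p; first by rewrite !subrr mulr0 add0r subrr normc0 mulr0.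
have zp0 : z - p != 0 by rewrite subr_eq0.
have := dP (z - p); rewrite subr0 => /(_ zpd zp0).
rewrite /= [_ *: 1]mulr1 subrK normr_normc ltcR => /ltW h.
rewrite (_ : f z - _ = - (l - (z - p)^-1 *: (f z - f p)) * (z - p)).
  by rewrite normcM normcN ler_wpM2r ?normc_ge0.
rewrite [_ *: _]mulrC mulNr mulrBl divfK//; ring.
Qed.

Lemma derivable_continuous f z : derivable f z 1 -> {for z, continuous f}.
Proof. by move=> /derivable1_diffP; exact: differentiable_continuous. Qed.

Lemma continuous_lin c f g z :
  {for z, continuous f} -> {for z, continuous g} ->
  {for z, continuous (fun x => c * f x + g x)}.
Proof.
move=> cf cg; have FF : Filter (nbhs z) by exact: nbhs_filter.
exact: (cvgD (cvgM (cvg_cst c) cf) cg).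
Qed.

Lemma continuous_affine c c' : continuous (fun z : R[i] => c * z + c').
Proof.
by move=> z; exact: (cvgD (cvgM (cvg_cst c) (@cvg_id _ (nbhs z))) (cvg_cst c')).
Qed.

Lemma derivable_quotient f g z : derivable f z 1 -> derivable g z 1 ->
  g z != 0 -> derivable (fun x => f x / g x) z 1.
Proof. by move=> df dg gz; exact: (derivableM df (derivableV gz dg)). Qed.

Lemma derivable_subC (c z : R[i]) : derivable (fun x : R[i] => x - c) z 1.
Proof. exact: (derivableB (@derivable_id _ R[i] z 1) (@derivable_cst _ _ _ c z 1)). Qed.

Lemma derivable_mul f g z : derivable f z 1 -> derivable g z 1 ->
  derivable (fun x => f x * g x) z 1.
Proof. by move=> df dg; exact: (derivableM df dg). Qed.

Lemma derivable_subCX c z n : derivable (fun x : R[i] => (x - c) ^+ n) z 1.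
Proof.
elim: n => [|n ih]; first exact: (@derivable_cst _ _ _ (1 : R[i]) z 1).
rewrite (_ : (fun x => _) = (fun x => (x - c) * (x - c) ^+ n)).
  by apply: derivable_mul; [exact: derivable_subC|exact: ih].
by apply/funext => x; rewrite exprS.
Qed.

End Differentiability.

(** * Integrals of complex functions over real segments *)

Section SegmentIntegral.
Variable R : realType.
Local Notation mu := (@lebesgue_measure R).
Implicit Types (a b m : R) (h : R -> R[i]) (c : R[i]).

Definition segment_integral a b h : R[i] :=
  ((\int[mu]_(t in `[a, b]) complex.Re (h t)) +i*
   (\int[mu]_(t in `[a, b]) complex.Im (h t)))%C.

Definition segment_continuous a b h :=
  forall t, a <= t <= b -> {for t, continuous h}.

Lemma segment_integrable a b (f : R -> R) :
  (forall t, a <= t <= b -> {for t, continuous f}) ->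
  mu.-integrable `[a, b] (EFin \o f).
Proof.
move=> cf; apply: continuous_compact_integrable; first exact: segment_compact.
by apply: continuous_in_subspaceT => t; rewrite inE/= in_itv/= => /cf.
Qed.

Lemma segment_integrable_Re a b h : segment_continuous a b h ->
  mu.-integrable `[a, b] (EFin \o (fun t => complex.Re (h t))).
Proof.
by move=> ch; apply: segment_integrable => t /ch; exact: continuous_Re_comp.
Qed.

Lemma segment_integrable_Im a b h : segment_continuous a b h ->
  mu.-integrable `[a, b] (EFin \o (fun t => complex.Im (h t))).
Proof.
by move=> ch; apply: segment_integrable => t /ch; exact: continuous_Im_comp.
Qed.

Lemma eq_segment_integral a b h1 h2 :
  (forall t, a <= t <= b -> h1 t = h2 t) ->
  segment_integral a b h1 = segment_integral a b h2.
Proof.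
move=> h12; rewrite /segment_integral; congr Complex;
  by apply: eq_Rintegral => t; rewrite inE/= in_itv/= => /h12 ->.
Qed.

Lemma segment_integralD a b h1 h2 :
  segment_continuous a b h1 -> segment_continuous a b h2 ->
  segment_integral a b (fun t => h1 t + h2 t) =
  segment_integral a b h1 + segment_integral a b h2.
Proof.
move=> ch1 ch2; rewrite /segment_integral.
under eq_Rintegral do rewrite raddfD/=.
under [X in (_ +i* X)%C = _]eq_Rintegral do rewrite raddfD/=.
rewrite !RintegralD//; [exact: segment_integrable_Im.. | |];
  exact: segment_integrable_Re.
Qed.

Lemma segment_integralZ a b c h : segment_continuous a b h ->
  segment_integral a b (fun t => c * h t) = c * segment_integral a b h.
Proof.
move=> ch; rewrite /segment_integral; case: c => u v.
have iR := segment_integrable_Re ch; have iI := segment_integrable_Im ch.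
have mI (x : R) (f : R -> R) : mu.-integrable `[a, b] (EFin \o f) ->
    mu.-integrable `[a, b] (EFin \o (fun t => x * f t)).
  by move=> fi; apply: (integrableZl _ x fi).
rewrite (_ : (_ +i* _)%C * _ =
  ((u * \int[mu]_(t in `[a, b]) complex.Re (h t) -
    v * \int[mu]_(t in `[a, b]) complex.Im (h t)) +i*
   (u * \int[mu]_(t in `[a, b]) complex.Im (h t) +
    v * \int[mu]_(t in `[a, b]) complex.Re (h t)))%C)//.
rewrite -!RintegralZl// -RintegralB -?RintegralD//; [|exact: mI..].
by congr Complex; apply: eq_Rintegral => t _; case: (h t).
Qed.

Lemma segment_integral_lin a b c h1 h2 :
  segment_continuous a b h1 -> segment_continuous a b h2 ->
  segment_integral a b (fun t => c * h1 t + h2 t) =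
  c * segment_integral a b h1 + segment_integral a b h2.
Proof.
move=> ch1 ch2; rewrite -(segment_integralZ c ch1).
apply: (segment_integralD _ ch2) => t abt.
by apply: cvgM; [exact: cvg_cst|exact: ch1].
Qed.

Lemma fine_measure_segment a b : a <= b -> fine (mu (`[a, b] : set R)) = b - a.
Proof.
move=> ab; rewrite lebesgue_measure_itv/= lte_fin.
by case: ltgtP ab => // -> _; rewrite subrr.
Qed.

Lemma segment_integral_cst a b c : a <= b ->
  segment_integral a b (fun=> c) = c * (b - a)%:C%C.
Proof.
move=> /fine_measure_segment mE.
rewrite /segment_integral !Rintegral_cst// mE.
by case: c => u v; apply/eqP; rewrite eq_complex/=; apply/andP; split; apply/eqP; ring.
Qed.

Lemma segment_integral_split a m b h : a <= m -> m <= b ->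
  segment_continuous a b h ->
  segment_integral a b h = segment_integral a m h + segment_integral m b h.
Proof.
move=> am mb ch.
have split (f : R -> R) : mu.-integrable `[a, b] (EFin \o f) ->
    \int[mu]_(t in `[a, b]) f t =
    \int[mu]_(t in `[a, m]) f t + \int[mu]_(t in `[m, b]) f t.
  move=> fi; rewrite -(@Rintegral_itv_obnd_cbnd _ m (BRight b)).
    rewrite -(@Rintegral_itvB _ f (BLeft a) (BRight b) m)//.
    by rewrite addrC subrK.
  apply: integrableS fi => // t /=; rewrite !in_itv/= => /andP[mt ->].
  by rewrite (le_trans am (ltW mt)).
rewrite /segment_integral !split//; first exact: segment_integrable_Im.
exact: segment_integrable_Re.
Qed.

(** The two coordinates are estimated separately; this costs the factor [2] and
    avoids rotating the integral onto the real axis. *)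
Lemma segment_integral_le a b h (M : R) : a <= b -> segment_continuous a b h ->
  (forall t, a <= t <= b -> normc (h t) <= M) ->
  normc (segment_integral a b h) <= 2 * M * (b - a).
Proof.
move=> ab ch hM.
have mE := fine_measure_segment ab.
have bound (f : R -> R) : mu.-integrable `[a, b] (EFin \o f) ->
    (forall t, a <= t <= b -> `|f t| <= M) ->
    `|\int[mu]_(t in `[a, b]) f t| <= M * (b - a).
  move=> fi fM; apply: (le_trans (le_normr_Rintegral _ fi)) => //.
  rewrite -mE -Rintegral_cst//; apply: le_Rintegral => //.
  - exact: integrable_norm fi.
  - by apply: segment_integrable => t _; exact: cvg_cst.
apply: (le_trans (normc_le_ReIm _)).
rewrite -mulrA mulr_natl mulr2n; apply: lerD; apply: bound => //.
- exact: segment_integrable_Re.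
- by move=> t /hM; apply: le_trans; exact: normr_Re_le.
- exact: segment_integrable_Im.
- by move=> t /hM; apply: le_trans; exact: normr_Im_le.
Qed.

Lemma segment_integral_Im_ge a b h (m : R) : a <= b -> segment_continuous a b h ->
  (forall t, a <= t <= b -> m <= complex.Im (h t)) ->
  m * (b - a) <= complex.Im (segment_integral a b h).
Proof.
move=> ab ch hm.
have mE := fine_measure_segment ab.
rewrite -mE -Rintegral_cst//; apply: le_Rintegral => //.
- by apply: segment_integrable => t _; exact: cvg_cst.
- exact: segment_integrable_Im.
Qed.

End SegmentIntegral.

(** * Integrals along the boundary of a rectangle *)

Section Rectangles.
Variable R : realType.
Implicit Types (f g : R[i] -> R[i]) (c z : R[i]).

Definition rectangle (x0 x1 y0 y1 : R) : set R[i] :=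
  [set z | x0 <= complex.Re z <= x1 /\ y0 <= complex.Im z <= y1].

Definition frame (x0 x1 y0 y1 : R) : set R[i] :=
  [set z | rectangle x0 x1 y0 y1 z /\
    [\/ complex.Re z = x0, complex.Re z = x1,
        complex.Im z = y0 | complex.Im z = y1]].

Definition continuous_at_points (A : set R[i]) f :=
  forall z, A z -> {for z, continuous f}.

(** Opposite sides are traversed in opposite directions, so they are paired
    under one integral sign; in this form the integral of an affine function
    visibly reduces to integrals of constants. *)
Definition rectangle_integral (x0 x1 y0 y1 : R) f : R[i] :=
  segment_integral x0 x1 (fun t => f (t +i* y0)%C - f (t +i* y1)%C) +
  'i%C * segment_integral y0 y1 (fun t => f (x1 +i* t)%C - f (x0 +i* t)%C).

Lemma continuous_at_pointsW (A B : set R[i]) f : A `<=` B ->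
  continuous_at_points B f -> continuous_at_points A f.
Proof. by move=> AB cf z /AB; exact: cf. Qed.

Lemma frame_sub_rectangle (x0 x1 y0 y1 : R) :
  frame x0 x1 y0 y1 `<=` rectangle x0 x1 y0 y1.
Proof. by move=> z []. Qed.

Lemma horizontal_continuous (a b y y' : R) f :
  (forall t, a <= t <= b -> {for (t +i* y)%C, continuous f}) ->
  (forall t, a <= t <= b -> {for (t +i* y')%C, continuous f}) ->
  segment_continuous a b (fun t => f (t +i* y)%C - f (t +i* y')%C).
Proof.
by move=> cy cy' t abt; apply: cvgB;
  [apply/continuous_horizontal/cy|apply/continuous_horizontal/cy'].
Qed.

Lemma vertical_continuous (a b x x' : R) f :
  (forall t, a <= t <= b -> {for (x +i* t)%C, continuous f}) ->
  (forall t, a <= t <= b -> {for (x' +i* t)%C, continuous f}) ->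
  segment_continuous a b (fun t => f (x +i* t)%C - f (x' +i* t)%C).
Proof.
by move=> cx cx' t abt; apply: cvgB;
  [apply/continuous_vertical/cx|apply/continuous_vertical/cx'].
Qed.

Lemma frame_continuous (x0 x1 y0 y1 : R) f : x0 <= x1 -> y0 <= y1 ->
  continuous_at_points (frame x0 x1 y0 y1) f ->
  segment_continuous x0 x1 (fun t => f (t +i* y0)%C - f (t +i* y1)%C) /\
  segment_continuous y0 y1 (fun t => f (x1 +i* t)%C - f (x0 +i* t)%C).
Proof.
move=> x01 y01 cf; split.
  apply: horizontal_continuous => t t01; apply: cf; split=> /=;
    rewrite /rectangle/= ?t01 ?lexx ?y01//; [by constructor 3|by constructor 4].
apply: vertical_continuous => t t01; apply: cf; split=> /=;
  rewrite /rectangle/= ?t01 ?lexx ?x01//; [by constructor 2|by constructor 1].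
Qed.

Lemma eq_rectangle_integral (x0 x1 y0 y1 : R) f g : x0 <= x1 -> y0 <= y1 ->
  (forall z, frame x0 x1 y0 y1 z -> f z = g z) ->
  rectangle_integral x0 x1 y0 y1 f = rectangle_integral x0 x1 y0 y1 g.
Proof.
move=> x01 y01 fg; rewrite /rectangle_integral; congr (_ + 'i%C * _);
  apply: eq_segment_integral => t t01; congr (_ - _); apply: fg; split=> /=;
  rewrite /rectangle/= ?t01 ?lexx ?x01 ?y01//.
- by constructor 3.
- by constructor 4.
- by constructor 2.
- by constructor 1.
Qed.

Lemma rectangle_integral_lin (x0 x1 y0 y1 : R) c f g : x0 <= x1 -> y0 <= y1 ->
  continuous_at_points (frame x0 x1 y0 y1) f ->
  continuous_at_points (frame x0 x1 y0 y1) g ->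
  rectangle_integral x0 x1 y0 y1 (fun z => c * f z + g z) =
  c * rectangle_integral x0 x1 y0 y1 f + rectangle_integral x0 x1 y0 y1 g.
Proof.
move=> x01 y01 /(frame_continuous x01 y01)[cf1 cf2].
move=> /(frame_continuous x01 y01)[cg1 cg2].
rewrite /rectangle_integral.
rewrite (_ : segment_integral x0 x1 _ = segment_integral x0 x1 (fun t =>
  c * (f (t +i* y0)%C - f (t +i* y1)%C) + (g (t +i* y0)%C - g (t +i* y1)%C))).
  rewrite (_ : segment_integral y0 y1 _ = segment_integral y0 y1 (fun t =>
    c * (f (x1 +i* t)%C - f (x0 +i* t)%C) + (g (x1 +i* t)%C - g (x0 +i* t)%C))).
    by rewrite !segment_integral_lin//; ring.
  by apply: eq_segment_integral => t _; ring.
by apply: eq_segment_integral => t _; ring.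
Qed.

(** On opposite sides an affine function differs by a constant, so both halves
    of the integral are those of constants, and the two halves cancel. *)
Lemma rectangle_integral_affine (x0 x1 y0 y1 : R) b c : x0 <= x1 -> y0 <= y1 ->
  rectangle_integral x0 x1 y0 y1 (fun z => c * z + b) = 0.
Proof.
move=> x01 y01; rewrite /rectangle_integral.
have mkB (x y x' y' : R) : c * (x +i* y)%C + b - (c * (x' +i* y')%C + b) =
    c * ((x - x') +i* (y - y'))%C.
  rewrite (_ : ((x - x') +i* _)%C = (x +i* y)%C - (x' +i* y')%C)//; ring.
rewrite (_ : segment_integral x0 x1 _ =
  c * (0 +i* (y0 - y1))%C * (x1 - x0)%:C%C); last first.
  rewrite -segment_integral_cst//; apply: eq_segment_integral => t _.
  by rewrite mkB subrr.
rewrite (_ : segment_integral y0 y1 _ = c * (x1 - x0)%:C%C * (y1 - y0)%:C%C); last first.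
  rewrite -segment_integral_cst//; apply: eq_segment_integral => t _.
  by rewrite mkB subrr.
rewrite (_ : (0 +i* (y0 - y1))%C = - 'i%C * (y1 - y0)%:C%C); first by ring.
by apply/eqP; rewrite eq_complex/=; apply/andP; split; apply/eqP; ring.
Qed.

Lemma rectangle_integral_le (x0 x1 y0 y1 M : R) f : x0 <= x1 -> y0 <= y1 ->
  continuous_at_points (frame x0 x1 y0 y1) f ->
  (forall z, frame x0 x1 y0 y1 z -> normc (f z) <= M) ->
  normc (rectangle_integral x0 x1 y0 y1 f) <=
    4 * M * ((x1 - x0) + (y1 - y0)).
Proof.
move=> x01 y01 /(frame_continuous x01 y01)[cf1 cf2] fM.
have normB (u v : R[i]) : normc u <= M -> normc v <= M -> normc (u - v) <= 2 * M.
  by move=> uM vM; rewrite mulr_natl mulr2n normc_sum_le// normcN.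
rewrite (_ : 4 * M * _ = 2 * (2 * M) * (x1 - x0) + 2 * (2 * M) * (y1 - y0)); last by ring.
apply: normc_sum_le; last (rewrite normcM [X in X * _](_ : _ = 1) ?mul1r; last first).
- apply: segment_integral_le => // t t01; apply: normB; apply: fM; split=> /=;
    rewrite /rectangle/= ?t01 ?lexx ?y01//; [by constructor 3|by constructor 4].
- by rewrite /= expr0n add0r expr1n sqrtr1.
- apply: segment_integral_le => // t t01; apply: normB; apply: fM; split=> /=;
    rewrite /rectangle/= ?t01 ?lexx ?x01//; [by constructor 2|by constructor 1].
Qed.

Lemma rectangle_integral_splitx (x0 m x1 y0 y1 : R) f :
  x0 <= m -> m <= x1 -> y0 <= y1 ->
  continuous_at_points (frame x0 m y0 y1) f ->
  continuous_at_points (frame m x1 y0 y1) f ->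
  rectangle_integral x0 x1 y0 y1 f =
  rectangle_integral x0 m y0 y1 f + rectangle_integral m x1 y0 y1 f.
Proof.
move=> x0m mx1 y01 cf1 cf2.
have [c1 c1'] := frame_continuous x0m y01 cf1.
have [c2 c2'] := frame_continuous mx1 y01 cf2.
rewrite /rectangle_integral (@segment_integral_split _ _ m)//; last first.
  by move=> t t01; have [tm|mt] := leP t m; [apply: c1|apply: c2]; lra.
rewrite (_ : segment_integral y0 y1 _ = segment_integral y0 y1 (fun t =>
  (f (m +i* t)%C - f (x0 +i* t)%C) + (f (x1 +i* t)%C - f (m +i* t)%C))).
  by rewrite (segment_integralD c1' c2'); ring.
by apply: eq_segment_integral => t _; ring.
Qed.

Lemma rectangle_integral_splity (x0 x1 y0 m y1 : R) f :
  x0 <= x1 -> y0 <= m -> m <= y1 ->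
  continuous_at_points (frame x0 x1 y0 m) f ->
  continuous_at_points (frame x0 x1 m y1) f ->
  rectangle_integral x0 x1 y0 y1 f =
  rectangle_integral x0 x1 y0 m f + rectangle_integral x0 x1 m y1 f.
Proof.
move=> x01 y0m my1 cf1 cf2.
have [c1 c1'] := frame_continuous x01 y0m cf1.
have [c2 c2'] := frame_continuous x01 my1 cf2.
rewrite /rectangle_integral (@segment_integral_split _ y0 m y1)//; last first.
  by move=> t t01; have [tm|mt] := leP t m; [apply: c1'|apply: c2']; lra.
rewrite (_ : segment_integral x0 x1 _ = segment_integral x0 x1 (fun t =>
  (f (t +i* y0)%C - f (t +i* m)%C) + (f (t +i* m)%C - f (t +i* y1)%C))).
  by rewrite (segment_integralD c1 c2); ring.
by apply: eq_segment_integral => t _; ring.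
Qed.

End Rectangles.

(** * Goursat's theorem *)

Section Goursat.
Variable R : realType.
Implicit Types (f g : R[i] -> R[i]) (c z : R[i]).

Lemma nested_intervals (u v : nat -> R) : (forall n, u n <= u n.+1) ->
  (forall n, v n.+1 <= v n) -> (forall n, u n <= v n) ->
  exists p, forall n, u n <= p <= v n.
Proof.
move=> /nondecreasing_seqP uS /nonincreasing_seqP vS uv.
have ub n m : u m <= v n.
  apply: (le_trans (uS _ _ (leq_maxl m n))).
  by apply: (le_trans (uv _)); apply/vS/leq_maxr.
exists (sup (range u)) => n; apply/andP; split.
  apply: ub_le_sup; last by exists n.
  by exists (v 0) => _ [m _ <-].
by apply: ge_sup => [|_ [m _ <-]//]; exists (u 0), 0.
Qed.

Lemma geometric_lt (K q d : R) : 0 <= q -> q < 1 -> 0 < d ->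
  exists n, K * q ^+ n < d.
Proof.
move=> q0 q1 d0; have /cvgrPdist_lt/(_ d d0)[n _ nP] :
    K * q ^+ k @[k --> \oo] --> (0 : R).
  rewrite -[X in _ --> X](mulr0 K); apply: cvgM; first exact: cvg_cst.
  by apply: cvg_expr; rewrite ger0_norm.
exists n; have := nP n (leqnn n); rewrite /= sub0r normrN; apply: le_lt_trans.
exact: ler_norm.
Qed.

(** The integral is the sum of the integrals over the four quarters, so they
    cannot all be small. *)
Lemma rectangle_quarter (x y a b K : R) f : 0 <= a -> 0 <= b ->
  continuous_at_points (rectangle x (x + 2 * a) y (y + 2 * b)) f ->
  4 * K < normc (rectangle_integral x (x + 2 * a) y (y + 2 * b) f) ->
  exists s : R * R, [/\ x <= s.1, s.1 + a <= x + 2 * a, y <= s.2,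
    s.2 + b <= y + 2 * b
    & K < normc (rectangle_integral s.1 (s.1 + a) s.2 (s.2 + b) f)].
Proof.
move=> a0 b0 cf; apply: contraPP => /forallNP nK; apply/negP; rewrite -leNgt.
have cf' (x0 x1 y0 y1 : R) : x <= x0 -> x1 <= x + 2 * a -> y <= y0 -> y1 <= y + 2 * b ->
    continuous_at_points (frame x0 x1 y0 y1) f.
  move=> h1 h2 h3 h4; apply: continuous_at_pointsW cf => z [[/andP[? ?] /andP[? ?]] _].
  by split; lra.
have le s : x <= s.1 -> s.1 + a <= x + 2 * a -> y <= s.2 -> s.2 + b <= y + 2 * b ->
    normc (rectangle_integral s.1 (s.1 + a) s.2 (s.2 + b) f) <= K.
  move=> h1 h2 h3 h4; rewrite leNgt; apply/negP => h; exact: (nK s).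
rewrite (@rectangle_integral_splitx _ _ (x + a)); [| lra | lra | lra |..]; last 2 first.
- by apply: cf'; lra.
- by apply: cf'; lra.
have sy x0 x1 : x <= x0 -> x0 <= x1 -> x1 <= x + 2 * a ->
    rectangle_integral x0 x1 y (y + 2 * b) f =
    rectangle_integral x0 x1 y (y + b) f +
    rectangle_integral x0 x1 (y + b) (y + 2 * b) f.
  move=> h1 h2 h3; apply: rectangle_integral_splity; [lra | lra | lra | |].
    by apply: cf'; lra.
  by apply: cf'; lra.
rewrite (sy x (x + a)); [|lra | lra | lra].
rewrite (sy (x + a)); [|lra | lra | lra].
rewrite (_ : 4 * K = (K + K) + (K + K)); last by ring.
have -> : x + 2 * a = x + a + a by ring.
have -> : y + 2 * b = y + b + b by ring.
apply: normc_sum_le; apply: normc_sum_le.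
- by apply: (le (x, y)) => /=; lra.
- by apply: (le (x, y + b)) => /=; lra.
- by apply: (le (x + a, y)) => /=; lra.
- by apply: (le (x + a, y + b)) => /=; lra.
Qed.

Lemma rectangle_normc_le (x0 x1 y0 y1 : R) z w :
  rectangle x0 x1 y0 y1 z -> rectangle x0 x1 y0 y1 w ->
  normc (z - w) <= (x1 - x0) + (y1 - y0).
Proof.
move=> [/andP[? ?] /andP[? ?]] [/andP[? ?] /andP[? ?]].
apply: (le_trans (normc_le_ReIm _)); rewrite !raddfB.
by apply: lerD; rewrite ler_norml; lra.
Qed.

(** If the integral were nonzero, repeated quartering would yield shrinking
    rectangles on which it stays above a fixed multiple of the area.  They
    close down on a point [p], where [f] is affine up to an error that is small
    compared with the distance to [p]; affine functions contribute nothing, so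
    the integral over a small rectangle around [p] is small compared with its
    area, a contradiction. *)
Theorem goursat (x0 x1 y0 y1 : R) f : x0 <= x1 -> y0 <= y1 ->
  (forall z, rectangle x0 x1 y0 y1 z -> derivable f z 1) ->
  rectangle_integral x0 x1 y0 y1 f = 0.
Proof.
move=> x01 y01 df; apply: contrapT => /eqP I0.
have cf : continuous_at_points (rectangle x0 x1 y0 y1) f.
  by move=> z /df; exact: derivable_continuous.
pose A := x1 - x0; pose B := y1 - y0; pose h n : R := 2^-1 ^+ n.
have hS n : h n = 2 * h n.+1 by rewrite /h exprS mulrA mulfV ?mul1r.
have h0 n : 0 < h n by rewrite /h exprn_gt0 ?invr_gt0.
have A0 : 0 <= A by rewrite subr_ge0.
have B0 : 0 <= B by rewrite subr_ge0.
have Ah0 n : 0 <= A * h n by rewrite mulr_ge0 ?(ltW (h0 n)).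
have Bh0 n : 0 <= B * h n by rewrite mulr_ge0 ?(ltW (h0 n)).
pose I n (s : R * R) :=
  rectangle_integral s.1 (s.1 + A * h n) s.2 (s.2 + B * h n) f.
have [e e0 eI] : exists2 e, 0 < e & e < normc (rectangle_integral x0 x1 y0 y1 f).
  have I1 := normc_gt0 I0.
  by exists (normc (rectangle_integral x0 x1 y0 y1 f) / 2); lra.
pose bad n (s : R * R) := [/\ x0 <= s.1, s.1 + A * h n <= x1, y0 <= s.2,
   s.2 + B * h n <= y1 & e * h n ^+ 2 < normc (I n s)].
have step (ns : nat * (R * R)) : exists t : R * R, bad ns.1 ns.2 ->
   [/\ bad ns.1.+1 t, ns.2.1 <= t.1,
       t.1 + A * h ns.1.+1 <= ns.2.1 + A * h ns.1, ns.2.2 <= t.2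
     & t.2 + B * h ns.1.+1 <= ns.2.2 + B * h ns.1].
  case: ns => n s /=.
  have [[sx sx' sy sy' sI]|nb] := pselect (bad n s); last by exists s.
  have AS : A * h n = 2 * (A * h n.+1) by rewrite (hS n); ring.
  have BS : B * h n = 2 * (B * h n.+1) by rewrite (hS n); ring.
  have := @rectangle_quarter s.1 s.2 (A * h n.+1) (B * h n.+1) (e * h n.+1 ^+ 2)
    f (Ah0 _) (Bh0 _).
  rewrite -AS -BS => /(_ _ _)[||t [tx tx' ty ty' tI]].
  - apply: continuous_at_pointsW cf => z [/andP[? ?] /andP[? ?]].
    by split; lra.
  - by move: sI; rewrite /I (hS n) exprMn; congr (_ < _); ring.
  exists t => _; split=> //; split=> //.
  - exact: le_trans tx.
  - exact: le_trans tx' sx'.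
  - exact: le_trans ty.
  - exact: le_trans ty' sy'.
(* [choice step] selects a bad quarter of every bad rectangle; iterating it
   from the given rectangle produces the nested sequence. *)
have [g gP] := choice step.
pose s := fix s n := if n is m.+1 then g (m, s m) else (x0, y0).
have bad0 : bad 0%N (x0, y0).
  by rewrite /bad /I /h/= !expr0 !mulr1 expr1n mulr1 !lexx /A /B !subrKC !lexx.
have sbad n : bad n (s n) by elim: n => [//|n ih]; have [] := gP (n, s n) ih.
have [p pP] : exists p, forall n, (s n).1 <= p <= (s n).1 + A * h n.
  apply: nested_intervals => n.
  - by have [] := gP (n, s n) (sbad n).
  - by have [] := gP (n, s n) (sbad n).
  - by rewrite lerDl.
have [q qP] : exists q, forall n, (s n).2 <= q <= (s n).2 + B * h n.
  apply: nested_intervals => n.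
  - by have [] := gP (n, s n) (sbad n).
  - by have [] := gP (n, s n) (sbad n).
  - by rewrite lerDl.
have pqx n : rectangle (s n).1 ((s n).1 + A * h n) (s n).2
    ((s n).2 + B * h n) (p +i* q)%C.
  by split => /=.
have pq0 : rectangle x0 x1 y0 y1 (p +i* q)%C.
  by have := pqx 0%N; rewrite /= /h expr0 !mulr1 /A /B !subrKC.
have [c cP] := derivable_affine_approx (df _ pq0).
(* [D * h n] bounds the diameter of the [n]-th rectangle; the summand [1] keeps
   [D] positive for a rectangle reduced to a point.  The relative error
   [e / (4 * D ^+ 2)] makes the final bound at most [e * h n ^+ 2]. *)
pose D := A + B + 1; have D0 : 0 < D by rewrite /D; lra.
have eD : 0 < e / (4 * D ^+ 2) by rewrite divr_gt0// mulr_gt0// exprn_gt0.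
have [d d0 dP] := cP _ eD.
have [n hn] : exists n, D * h n < d.
  by apply: geometric_lt; rewrite // ?invr_ge0// invf_lt1// ltr1n.
have [sx sx' sy sy' sI] := sbad n.
have sub : rectangle (s n).1 ((s n).1 + A * h n) (s n).2 ((s n).2 + B * h n) `<=`
    rectangle x0 x1 y0 y1.
  by move=> z [/andP[? ?] /andP[? ?]]; split; lra.
have lt_d z : rectangle (s n).1 ((s n).1 + A * h n) (s n).2 ((s n).2 + B * h n) z ->
    normc (z - (p +i* q)%C) <= D * h n.
  move=> /rectangle_normc_le/(_ (pqx n))/le_trans; apply.
  rewrite [X in X <= _](_ : _ = (A + B) * h n); last by ring.
  by rewrite ler_wpM2r ?(ltW (h0 _))// /D; lra.
pose r z := f z - (c * (z - (p +i* q)%C) + f (p +i* q)%C).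
pose b' := c * (p +i* q)%C - f (p +i* q)%C.
have rE : r = (fun z => 1 * f z + (- c * z + b')).
  by apply/funext => z; rewrite /r /b'; ring.
move: sI; apply/negP; rewrite -leNgt.
rewrite (_ : I n (s n) = rectangle_integral (s n).1 ((s n).1 + A * h n)
    (s n).2 ((s n).2 + B * h n) r); last first.
  rewrite rE rectangle_integral_lin ?lerDl//; last 2 first.
  - by apply: continuous_at_pointsW cf; apply: subset_trans sub;
      exact: frame_sub_rectangle.
  - by move=> z _; exact: continuous_affine.
  by rewrite rectangle_integral_affine ?lerDl// mul1r addr0.
have cr : continuous_at_points (frame (s n).1 ((s n).1 + A * h n)
    (s n).2 ((s n).2 + B * h n)) r.
  move=> z /frame_sub_rectangle/sub/cf fz.
  rewrite rE.
  by apply: continuous_lin; [exact: fz|exact: continuous_affine].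
have := @rectangle_integral_le _ _ _ _ _ (e / (4 * D ^+ 2) * (D * h n)) r _ _ cr.
rewrite !lerDl => /(_ (Ah0 _) (Bh0 _)) /(_ _)/le_trans; apply.
  move=> z /frame_sub_rectangle zs; apply: (le_trans (dP _ _)).
    by apply: le_lt_trans hn; exact: lt_d.
  rewrite ler_wpM2l ?lt_d//.
  by rewrite divr_ge0 ?(ltW e0)// mulr_ge0// exprn_ge0 ?(ltW D0).
rewrite [X in X <= _](_ : _ = e * h n ^+ 2 * ((A + B) / D)); last first.
  by field; rewrite gt_eqF.
rewrite ler_piMr// ?mulr_ge0 ?(ltW e0)// ?exprn_ge0 ?(ltW (h0 _))//.
by rewrite ler_pdivrMr// mul1r /D lerDl.
Qed.

End Goursat.

(** * Cauchy's estimate *)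

Section CauchyEstimate.
Variable R : realType.
Implicit Types (f g : R[i] -> R[i]) (c z w : R[i]).

(** Cutting a square of half-side [e] around [w] out of the rectangle leaves four
    rectangles to which [goursat] applies.  The integral is therefore that along
    the small square, which is of the order of [M * e]. *)
Lemma goursat_punctured (x0 x1 y0 y1 M d : R) f w :
  x0 < complex.Re w < x1 -> y0 < complex.Im w < y1 ->
  (forall z, rectangle x0 x1 y0 y1 z -> z != w -> derivable f z 1) ->
  0 < d -> (forall z, z != w -> normc (z - w) < d -> normc (f z) <= M) ->
  rectangle_integral x0 x1 y0 y1 f = 0.
Proof.
case: w => u v /= /andP[x0u ux1] /andP[y0v vy1] df d0 fM.
(* Points of the square of half-side [e] are at distance at most [4 * e] from
   [w], hence at distance less than [d] when [e <= d / 5]. *)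
pose e0 := Num.min (Num.min (u - x0) (x1 - u))
                   (Num.min (Num.min (v - y0) (y1 - v)) (d / 5)).
have [e00 [e1 e2 [e3 e4 e5]]] : 0 < e0 /\ [/\ e0 <= u - x0, e0 <= x1 - u &
    [/\ e0 <= v - y0, e0 <= y1 - v & e0 <= d / 5]].
  split; first by rewrite !lt_min; lra.
  by rewrite !ge_min !lexx ?orbT.
have cf (a0 a1 b0 b1 : R) : x0 <= a0 -> a1 <= x1 -> y0 <= b0 -> b1 <= y1 ->
    a0 != u -> a1 != u -> b0 != v -> b1 != v ->
    continuous_at_points (frame a0 a1 b0 b1) f.
  move=> ? ? ? ? a0u a1u b0v b1v [s t] [[/andP[/= ? ?] /andP[/= ? ?]] st].
  apply/derivable_continuous/df; first by split=> /=; lra.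
  by case: st => /= ->; rewrite eq_complex/= ?(negPf a0u) ?(negPf a1u)
    ?(negPf b0v) ?(negPf b1v) ?andbF.
have goursat0 (a0 a1 b0 b1 : R) : x0 <= a0 -> a1 <= x1 -> y0 <= b0 -> b1 <= y1 ->
    a0 <= a1 -> b0 <= b1 -> ~~ (a0 <= u <= a1) || ~~ (b0 <= v <= b1) ->
    rectangle_integral a0 a1 b0 b1 f = 0.
  move=> ? ? ? ? ? ? out; apply: goursat => // -[s t] [/= sa tb].
  apply: df; first by split=> /=; lra.
  by apply: contraL out => /eqP[<- <-]; rewrite sa tb.
have small (e : R) : 0 < e -> e <= e0 ->
    normc (rectangle_integral x0 x1 y0 y1 f) <= 16 * M * e.
  move=> epos ee0.
  rewrite (@rectangle_integral_splitx _ x0 (u - e));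
    [|lra | lra | lra | |]; last 2 first.
  - by apply: cf; lra.
  - by apply: cf; lra.
  rewrite [X in X + _]goursat0 ?add0r; [|lra..].
  rewrite (@rectangle_integral_splitx _ _ (u + e) x1);
    [|lra | lra | lra | |]; last 2 first.
  - by apply: cf; lra.
  - by apply: cf; lra.
  rewrite [X in _ + X]goursat0 ?addr0; [|lra..].
  rewrite (@rectangle_integral_splity _ _ _ y0 (v - e));
    [|lra | lra | lra | |]; last 2 first.
  - by apply: cf; lra.
  - by apply: cf; lra.
  rewrite [X in X + _]goursat0 ?add0r; [|lra..].
  rewrite (@rectangle_integral_splity _ _ _ _ (v + e) y1);
    [|lra | lra | lra | |]; last 2 first.
  - by apply: cf; lra.
  - by apply: cf; lra.
  rewrite [X in _ + X]goursat0 ?addr0; [|lra..].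
  have -> : 16 * M * e = 4 * M * ((u + e - (u - e)) + (v + e - (v - e))) by ring.
  apply: rectangle_integral_le; [lra | lra | by apply: cf; lra|].
  move=> z [zr zf]; apply: fM.
    by apply/eqP => zE; move: zf; rewrite zE => -[] /=; lra.
  have : rectangle (u - e) (u + e) (v - e) (v + e) (u +i* v)%C by split=> /=; lra.
  by move=> /(rectangle_normc_le zr) /le_lt_trans; apply; lra.
apply/eq0_normc/eqP; rewrite eq_le normc_ge0 andbT leNgt; apply/negP => I0.
have [||n] := @geometric_lt R (16 * M * e0) 2^-1 _ _ _ I0; [by lra | by lra |].
apply/negP; rewrite -leNgt -mulrA; apply: small.
  by rewrite mulr_gt0// exprn_gt0.
by rewrite ler_piMr ?(ltW e00)// exprn_ile1//; lra.
Qed.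

(** The value is the winding constant [2 * pi * 'i], but only its being nonzero
    matters: on each side the integrand contributes a positive imaginary
    part. *)
Lemma rectangle_winding_neq0 (x0 x1 y0 y1 : R) w :
  x0 < complex.Re w < x1 -> y0 < complex.Im w < y1 ->
  0 < normc (rectangle_integral x0 x1 y0 y1 (fun z => (z - w)^-1)).
Proof.
case: w => u v; rewrite [complex.Re _]/= [complex.Im _]/=.
move=> /andP[x0u ux1] /andP[y0v vy1].
pose h1 t := ((t +i* y0) - (u +i* v))%C^-1 - ((t +i* y1) - (u +i* v))%C^-1.
pose h2 t := ((x1 +i* t) - (u +i* v))%C^-1 - ((x0 +i* t) - (u +i* v))%C^-1.
have [ch1 ch2] : segment_continuous x0 x1 h1 /\ segment_continuous y0 y1 h2.
  apply: (@frame_continuous _ _ _ _ _ (fun z => (z - (u +i* v)%C)^-1)); [lra | lra |].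
  move=> z [_ zf]; apply: derivable_continuous; apply: derivableV.
    rewrite subr_eq0; apply/eqP => zE; move: zf; rewrite zE => -[] /=; lra.
  exact: derivable_subC.
pose D := (x1 - x0) ^+ 2 + (y1 - y0) ^+ 2.
pose m := (v - y0) / D.
have D0 : 0 < D by rewrite /D ltr_pwDl ?sqr_ge0// exprn_gt0//; lra.
have m0 : 0 < m by rewrite divr_gt0//; lra.
have I1 : m * (x1 - x0) <= complex.Im (segment_integral x0 x1 h1).
  apply: segment_integral_Im_ge => [|//|t t01]; first by lra.
  rewrite (_ : h1 t = ((t - u) +i* (y0 - v))%C^-1 - ((t - u) +i* (y1 - v))%C^-1)//.
  rewrite ImB !Im_inv opprB -[leLHS]addr0; apply: lerD; last first.
    by rewrite mulNr opprK divr_ge0//; [lra|rewrite addr_ge0 ?sqr_ge0].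
  rewrite ler_wpM2l//; first by lra.
  have X2 : (t - u) ^+ 2 <= (x1 - x0) ^+ 2.
    by rewrite -subr_ge0 subr_sqr mulr_ge0//; lra.
  have Y2 : (y0 - v) ^+ 2 <= (y1 - y0) ^+ 2.
    by rewrite -subr_ge0 subr_sqr mulr_ge0//; lra.
  have Y0 : 0 < (y0 - v) ^+ 2 by rewrite -sqrrN exprn_gt0//; lra.
  by rewrite lef_pV2 ?posrE// ?lerD// ltr_wpDl// sqr_ge0.
have I2 : 0 * (y1 - y0) <= complex.Im (segment_integral y0 y1 (fun t => 'i%C * h2 t)).
  apply: segment_integral_Im_ge => [||t t01]; first by lra.
    move=> t t01; have FF : Filter (nbhs t) by exact: nbhs_filter.
    exact: (cvgM (cvg_cst _) (ch2 t t01)).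
  rewrite mulrC ImiRe (_ : h2 t =
    ((x1 - u) +i* (t - v))%C^-1 - ((x0 - u) +i* (t - v))%C^-1)//.
  rewrite ReB !Re_inv subr_ge0; apply: (@le_trans _ _ 0).
    by rewrite mulr_le0_ge0//; [lra|rewrite invr_ge0 addr_ge0 ?sqr_ge0].
  by rewrite divr_ge0//; [lra|rewrite addr_ge0 ?sqr_ge0].
rewrite (_ : rectangle_integral _ _ _ _ _ = segment_integral x0 x1 h1 +
  segment_integral y0 y1 (fun t => 'i%C * h2 t)); last first.
  by rewrite (segment_integralZ _ ch2).
apply: lt_le_trans (normr_Im_le _); apply: lt_le_trans (ler_norm _).
rewrite raddfD/=; apply: ltr_pwDl; last by move: I2; rewrite mul0r.
by apply: lt_le_trans I1; rewrite mulr_gt0//; lra.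
Qed.

Lemma frame_dist (x0 x1 y0 y1 : R) w :
  x0 < complex.Re w < x1 -> y0 < complex.Im w < y1 ->
  exists2 d, 0 < d & forall z, frame x0 x1 y0 y1 z -> d <= normc (z - w).
Proof.
case: w => u v; rewrite [complex.Re _]/= [complex.Im _]/=.
move=> /andP[x0u ux1] /andP[y0v vy1].
exists (Num.min (Num.min (u - x0) (x1 - u)) (Num.min (v - y0) (y1 - v))).
  by rewrite !lt_min; lra.
move=> [s t] [_ zf]; rewrite !ge_min.
have hR := normr_Re_le ((s +i* t)%C - (u +i* v)%C).
have hI := normr_Im_le ((s +i* t)%C - (u +i* v)%C).
move: hR hI zf; rewrite ReB ImB [complex.Re (s +i* t)%C]/= [complex.Im (s +i* t)%C]/=
  [complex.Re (u +i* v)%C]/= [complex.Im (u +i* v)%C]/=.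
move: (normc _) => N; rewrite !ler_norml => hR hI [] E; rewrite E in hR hI *.
- by apply/orP; left; apply/orP; left; lra.
- by apply/orP; left; apply/orP; right; lra.
- by apply/orP; right; apply/orP; left; lra.
- by apply/orP; right; apply/orP; right; lra.
Qed.

(** The difference quotient [q z = (g z - g w) / (z - w)] is bounded near [w], so
    its integral vanishes and [g w] times the winding constant equals the
    integral of [g z / (z - w)].  That [K] is independent of [g] is what allows
    the estimate to be used for infinitely many functions at once. *)
Lemma cauchy_estimate (x0 x1 y0 y1 : R) w :
  x0 < complex.Re w < x1 -> y0 < complex.Im w < y1 ->
  exists K, forall g M,
    (forall z, rectangle x0 x1 y0 y1 z -> derivable g z 1) ->
    (forall z, frame x0 x1 y0 y1 z -> normc (g z) <= M) ->
    normc (g w) <= K * M.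
Proof.
move=> wx wy; have [d d0 dP] := frame_dist wx wy.
have := rectangle_winding_neq0 wx wy; set W := rectangle_integral _ _ _ _ _ => W0.
have [x01 y01] : x0 <= x1 /\ y0 <= y1 by lra.
pose L := (x1 - x0) + (y1 - y0).
exists (4 * L / (d * normc W)) => g M dg gM.
have fw z : frame x0 x1 y0 y1 z -> z - w != 0.
  by move=> /dP dz; apply: contraTneq (lt_le_trans d0 dz) => ->; rewrite normc0 ltxx.
have wr : rectangle x0 x1 y0 y1 w.
  by move: wx wy => /andP[/ltW ? /ltW ?] /andP[/ltW ? /ltW ?]; split; apply/andP.
pose q z := (g z - g w) / (z - w).
have dq z : rectangle x0 x1 y0 y1 z -> z != w -> derivable q z 1.
  move=> zr zw; apply: derivable_quotient.
  - exact: (derivableB (dg z zr) (@derivable_cst _ _ _ (g w) z 1)).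
  - exact: derivable_subC.
  - by rewrite subr_eq0.
have Iq : rectangle_integral x0 x1 y0 y1 q = 0.
  have [c /(_ 1 ltr01)[e e0 eP]] := derivable_affine_approx (dg w wr).
  apply: (@goursat_punctured _ _ _ _ (1 + normc c) e q w) => // z zw ze.
  have zw0 : 0 < normc (z - w) by rewrite normc_gt0// subr_eq0.
  rewrite /q normcM normcV ler_pdivrMr//.
  rewrite (_ : g z - g w = (g z - (c * (z - w) + g w)) + c * (z - w)); last by ring.
  by rewrite mulrDl -normcM normc_sum_le// eP.
have cinv : continuous_at_points (frame x0 x1 y0 y1) (fun z => (z - w)^-1).
  move=> z /fw zw; apply: derivable_continuous.
  by apply: derivableV; [exact: zw|exact: derivable_subC].
have cq : continuous_at_points (frame x0 x1 y0 y1) q.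
  move=> z zf; apply: derivable_continuous; apply: dq; first by case: zf.
  by rewrite -subr_eq0 fw.
have Ig : rectangle_integral x0 x1 y0 y1 (fun z => g z / (z - w)) = g w * W.
  rewrite -[RHS]addr0 -Iq -(rectangle_integral_lin _ x01 y01 cinv cq).
  apply: eq_rectangle_integral => // z /fw zw.
  by rewrite /q; ring.
have cg : continuous_at_points (frame x0 x1 y0 y1) (fun z => g z / (z - w)).
  move=> z zf; apply: derivable_continuous; apply: derivable_quotient.
  - by apply: dg; case: zf.
  - exact: derivable_subC.
  - exact: fw.
have gd z : frame x0 x1 y0 y1 z -> normc (g z / (z - w)) <= M / d.
  move=> zf; rewrite normcM normcV; apply: ler_pM; rewrite ?invr_ge0 ?normc_ge0//.
    exact: gM.
  have := dP z zf => dz.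
  by rewrite lef_pV2// posrE// (lt_le_trans d0).
have := rectangle_integral_le x01 y01 cg gd.
rewrite Ig normcM -ler_pdivlMr// => /le_trans; apply.
rewrite le_eqVlt; apply/orP; left; apply/eqP; rewrite /L; field.
by rewrite !gt_eqF.
Qed.

End CauchyEstimate.

(** * The identity theorem *)

Section IdentityTheorem.
Variable R : realType.
Implicit Types (f g : R[i] -> R[i]) (c z w : R[i]) (Omega : set R[i]).

(** All the quotients [f z / (z - c) ^+ n] are holomorphic, and on the boundary of
    the square they are at most [M / r ^+ n].  Cauchy's estimate at [w] gives
    [normc (f w) <= K * M * (normc (w - c) / r) ^+ n] for every [n]. *)
Lemma zero_propagates (r M : R) f c : 0 < r ->
  (forall z, rectangle (complex.Re c - r) (complex.Re c + r)
                       (complex.Im c - r) (complex.Im c + r) z ->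
     derivable f z 1 /\ normc (f z) <= M) ->
  (\forall z \near c, f z = 0) ->
  forall w, normc (w - c) < r -> f w = 0.
Proof.
move=> r0 fP f0 w wcr.
have [->|wc] := eqVneq w c; first exact: nbhs_singleton f0.
set x0 := complex.Re c - r in fP; set x1 := complex.Re c + r in fP.
set y0 := complex.Im c - r in fP; set y1 := complex.Im c + r in fP.
have [wx wy] : x0 < complex.Re w < x1 /\ y0 < complex.Im w < y1.
  have := le_lt_trans (normr_Re_le _) wcr; rewrite ReB ltr_norml => ?.
  have := le_lt_trans (normr_Im_le _) wcr; rewrite ImB ltr_norml => ?.
  by rewrite /x0 /x1 /y0 /y1; split; lra.
have [K KP] := cauchy_estimate wx wy.
have rz z : frame x0 x1 y0 y1 z -> r <= normc (z - c).
  move=> [_ zf]; have := normr_Re_le (z - c); have := normr_Im_le (z - c).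
  rewrite ReB ImB !ler_norml => hI hR.
  by case: zf => E; rewrite E in hR hI; move: hR hI; rewrite /x0 /x1 /y0 /y1; lra.
have wc0 : 0 < normc (w - c) by rewrite normc_gt0// subr_eq0.
have est n : normc (f w) <= K * M * (normc (w - c) / r) ^+ n.
  have := KP (fun z => f z / (z - c) ^+ n) (M / r ^+ n).
  rewrite normcM normcV normcX ler_pdivrMr ?exprn_gt0// expr_div_n.
  rewrite (_ : K * (M / r ^+ n) * normc (w - c) ^+ n =
    K * M * (normc (w - c) ^+ n / r ^+ n)); last by ring.
  apply=> [z zr|z zf].
    (* At [c] the quotient is differentiable because it vanishes near [c]. *)
    have [->|zc] := eqVneq z c.
      apply: near_eq_derivable (@derivable_cst _ R[i] R[i] 0 c 1).
      by apply: filterS f0 => x ->; rewrite mul0r.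
    apply: derivable_quotient; [by case: (fP z zr)|exact: derivable_subCX|].
    by rewrite expf_neq0// subr_eq0.
  rewrite normcM normcV normcX.
  apply: ler_pM; rewrite ?invr_ge0 ?exprn_ge0 ?normc_ge0//.
    by case: zf => /fP[].
  have zc0 : 0 < normc (z - c) by exact: lt_le_trans (rz z zf).
  by rewrite lef_pV2 ?posrE ?exprn_gt0// lerXn2r ?nnegrE ?normc_ge0 ?(ltW r0)// rz.
apply/eq0_normc/eqP; rewrite eq_le normc_ge0 andbT leNgt; apply/negP => fw0.
have q1 : normc (w - c) / r < 1 by rewrite ltr_pdivrMr ?mul1r.
have q0 : 0 <= normc (w - c) / r by rewrite divr_ge0 ?normc_ge0 ?(ltW r0).
have [n] := geometric_lt (K * M) q0 q1 fw0.
by apply/negP; rewrite -leNgt.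
Qed.

(** The points of [Omega] near which [f] vanishes form an open set; it is also
    closed in [Omega], because a point [e] of it close to [p] is the centre of a
    square contained in [Omega] whose inscribed disc contains [p]. *)
Theorem identity_theorem Omega f c : open Omega -> connected Omega ->
  holomorphic_on Omega f -> Omega c -> (\forall z \near c, f z = 0) ->
  forall z, Omega z -> f z = 0.
Proof.
move=> oO cO hf Oc fc.
pose E := [set z | Omega z /\ \forall x \near z, f x = 0].
suff EO : E = Omega by move=> z; rewrite -EO => -[_ /nbhs_singleton].
apply: cO; first by exists c.
  by exists (interior [set z | f z = 0]); [exact: open_interior|].
exists (closure E); first exact: closed_closure.
apply/seteqP; split=> [z Ez|p [Op clE]]; first by split; [case: Ez|exact: subset_closure].
split; first exact: Op.
have [d d0 dP] : exists2 d : R, 0 < d &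
    forall x, normc (x - p) < d -> derivable f x 1 /\ normc (f x) <= normc (f p) + 1.
  have [d1 d10 d1P] : exists2 d : R, 0 < d & forall x, normc (x - p) < d -> Omega x.
    exact/nbhs_normcP/open_nbhs_nbhs.
  have [d2 d20 d2P] : exists2 d : R, 0 < d &
      forall x, normc (x - p) < d -> normc (f x - f p) < 1.
    apply/nbhs_normcP.
    by have /continuous_normcP/(_ 1 ltr01) := derivable_continuous (hf p Op).
  exists (Num.min d1 d2); first by rewrite lt_min d10.
  move=> x; rewrite lt_min => /andP[xd1 xd2]; split; first exact/hf/d1P.
  rewrite (_ : f x = f p + (f x - f p)); last by ring.
  by rewrite normc_sum_le// ltW// d2P.
have [e [[Oe fe] epd]] : exists e, E e /\ normc (e - p) < d / 4.
  have [e [Ee ep]] : E `&` [set x | normc (x - p) < d / 4] !=set0.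
    by apply: clE; apply/nbhs_normcP; exists (d / 4) => //; lra.
  by exists e.
(* The square of half-side [d / 4] centred at [e] stays within [3 * d / 4] of
   [p], where [f] is differentiable and bounded. *)
apply/nbhs_normcP; exists (d / 4 - normc (e - p)); first by lra.
move=> x xp; apply: (@zero_propagates (d / 4) (normc (f p) + 1) f e) => //.
- by lra.
- move=> z [zx zy]; apply: dP.
  have ze : normc (z - e) <= d / 4 + d / 4.
    apply: (le_trans (normc_le_ReIm _)); rewrite ReB ImB.
    by apply: lerD; rewrite ler_norml; lra.
  have := le_normcD (z - e) (e - p); rewrite subrKA => /le_lt_trans; apply; lra.
- have := le_normcD (x - p) (p - e); rewrite subrKA => /le_lt_trans; apply.
  by rewrite -(normcN (p - e)) opprB; lra.
Qed.

(** Where [f] does not vanish it stays away from [0] nearby, so a vanishing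
    product would make [g] vanish near that point, hence everywhere. *)
Lemma nonzero_onM Omega f g : open Omega -> connected Omega ->
  holomorphic_on Omega f -> holomorphic_on Omega g ->
  nonzero_on Omega f -> nonzero_on Omega g ->
  nonzero_on Omega (fun z => f z * g z).
Proof.
move=> oO cO hf hg [c Oc fc] [z Oz gz]; apply: contrapT => fg0.
have fgE x : Omega x -> f x * g x = 0.
  by move=> Ox; apply/eqP; apply: contrapT => /negP fgx; apply: fg0; exists x.
move/eqP: gz; apply; apply: (identity_theorem oO cO hg Oc) => //.
have fc0 := normc_gt0 fc.
have cf : {for c, continuous f} by exact: derivable_continuous (hf c Oc).
have Onear : \forall x \near c, Omega x by exact: open_nbhs_nbhs.
have cnear := (continuous_normcP f c).1 cf _ fc0.
apply: filterS2 Onear cnear => x Ox fxc.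
have /eqP := fgE x Ox; rewrite mulf_eq0 => /orP[/eqP fx0|/eqP//].
by move: fxc; rewrite fx0 sub0r normcN ltxx.
Qed.

End IdentityTheorem.

(** * Algebraic elements *)

Lemma HinfM (R : realType) (Omega : set R[i]) (f g : R[i] -> R[i]) :
  Hinf Omega f -> Hinf Omega g -> Hinf Omega (fun z => f z * g z).
Proof.
move=> [hf bf] [hg bg]; split.
  by move=> z Oz; apply: derivable_mul; [exact: hf|exact: hg].
have [M M0 Mf] := ex_strict_bound_gt0 bf.
have [N N0 Ng] := ex_strict_bound_gt0 bg.
exists (M * N); split=> [|K MNK _ [z Oz <-]].
  by rewrite gtr0_real// mulr_gt0.
rewrite /= normrM (le_trans _ (ltW MNK))// ler_pM// ltW//.
  by apply: Mf; exists z.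
by apply: Ng; exists z.
Qed.

Theorem theorem2p6 (R : realType) (H : completeNormedModType R[i])
    (ip : {dot H for @Num.conj R[i]}) (H_hilbert : induces_norm ip)
    (Omega : set R[i]) (Omega_region : analytic_region Omega)
    (z0 : R[i]) (z0_in : Omega z0)
    (omega : probability (Borel_plane R) R)
    (omega_harmonic : harmonic_measure Omega z0 omega)
    (T : H -> H) (T_h : hypothesis_h ip Omega T)
    (Phi : (R[i] -> R[i]) -> H -> H)
    (Phi_calculus : functional_calculus ip Omega omega T Phi)
    (B : closed_subspace H)
    (B_algebraic : (B : set H) = [set h | algebraic Omega Phi h])
    (a : H) :
  algebraic_in_quotient Omega Phi (coset B a) <-> algebraic Omega Phi a.
Proof.
have Phi0 f : Hinf Omega f -> Phi f 0 = 0.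
  move=> /(fcalc_bounded Phi_calculus)[_ linf _].
  by have := linf (- 1) 0 0 I I; rewrite scaler0 addr0 scaleN1r addNr.
(* The values of the functional calculus commute, so what annihilates [x] also
   annihilates [Phi f x]: [B] is invariant. *)
have PhiB f x : Hinf Omega f -> (B : set H) x -> (B : set H) (Phi f x).
  move=> hf; rewrite B_algebraic => -[g [hg g0 gx]]; exists g; split=> //.
  have := fcalc_mul Phi_calculus hg hf; rewrite (_ : (fun z => _) = (fun z => f z * g z)).
    rewrite (fcalc_mul Phi_calculus hf hg) => /(congr1 (fun F => F x)) /= <-.
    by rewrite gx Phi0.
  by apply/funext => z; rewrite mulrC.
have coset0P x : coset B x = 0 <-> (B : set H) x.
  rewrite -[X in (B : set H) X]subr0 -coset_eq.
  have -> : coset B 0 = 0 by exact: pi_zeror.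
  by [].
have quotientE f : Hinf Omega f ->
    quotient_op (Phi f) (coset B a) = coset B (Phi f a).
  move=> hf; apply: quotient_opE; first exact: fcalc_bounded Phi_calculus _ hf.
  by move=> x; exact: PhiB.
have oO := region_open Omega_region; have cO := region_connected Omega_region.
split=> [[f [hf f0]]|[f [hf f0 fa]]].
  rewrite quotientE// => /coset0P; rewrite B_algebraic => -[g [hg g0 gfa]].
  exists (fun z => g z * f z); split; first exact: HinfM.
    by apply: nonzero_onM => //; [case: hg|case: hf].
  by rewrite (fcalc_mul Phi_calculus hg hf).
exists f; split=> //; rewrite quotientE// fa; apply/coset0P; exact: subspace0.
Qed.
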